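(* Let $(M_n^t)_{0\le t\le n}$ be the random mine process on the rectangular grid $G_n$: $M_n^0$ is the empty mine assignment, and $M_n^{t+1}$ is obtained from $M_n^t$ by picking uniformly at random one of its empty cells (independently at each step) and adding a mine in it. Let $\tau$ be the smallest $t$ such that $M_n^t$ contains an occurrence of $\mathcal P_1$ or $\mathcal P_2$ ($\tau=\infty$ if there is no such $t$). Conditionally on $\tau<n^{0.9}$ and on $M_n^\tau$, with high probability, for all $\tau<t<n/2$, $M_n^t$ contains at least one occurrence of $\mathcal P_1$ or $\mathcal P_2$.
   Context: Grids. Let $(a_N),(b_N)$ be two integer sequences tending to infinity; $n=n(N)=a_Nb_N$ and $G_n$ is the rectangular $a_N\times b_N$ grid. ''With high probability'' means with (here conditional) probability tending to $1$ as $n\to\infty$ along this sequence. A mine assignment on a grid gives each cell the value ''empty'' or ''mine''. $\mathcal P_1$ and $\mathcal P_2$ are mine assignments on an $8\times8$ grid with exactly 6 mines each (rows and columns numbered $1,\dots,8$): both have mines at $(3,3),(3,6),(6,3),(6,6)$; in addition $\mathcal P_1$ has mines at $(4,4),(5,5)$ and $\mathcal P_2$ has mines at $(4,5),(5,4)$. All other cells are empty. A mine assignment $M$ contains an occurrence of $\mathcal P_i$ if some $8\times 8$ subgrid (of consecutive rows and columns) of $M$ coincides with $\mathcal P_i$. *)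

(* Defs.v *)
From HB Require Import structures.
From mathcomp Require Import all_boot all_order all_algebra.
From mathcomp Require Import all_classical all_reals all_analysis.

Set Implicit Arguments.
Unset Strict Implicit.
Unset Printing Implicit Defensive.

Import Order.TTheory GRing.Theory Num.Theory.
Local Open Scope ring_scope.

Definition cell (a b : nat) : finType := ('I_a * 'I_b)%type.

(* A mine assignment is represented by its set of mines; the empty cells form
   the complement. *)
Definition mines (a b : nat) : finType := {set cell a b}.

(* Ordinals are numbered from 0, the coordinates listed in s from 1. *)
Definition pattern (s : seq (nat * nat)) : mines 8 8 :=
  [set u : cell 8 8 | (u.1.+1, u.2.+1) \in s]%SET.

Definition P1 : mines 8 8 :=
  pattern [:: (3, 3); (3, 6); (6, 3); (6, 6); (4, 4); (5, 5)]%N.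

Definition P2 : mines 8 8 :=
  pattern [:: (3, 3); (3, 6); (6, 3); (6, 6); (4, 5); (5, 4)]%N.

(* The content of the 8 x 8 window with top left corner (i, j). *)
Definition subgrid (a b : nat) (m : mines a b) (i j : nat) : mines 8 8 :=
  [set u : cell 8 8 |
    [exists c in m, (c.1 == i + u.1 :> nat)%N && (c.2 == j + u.2 :> nat)%N]]%SET.

Definition occurs (p : mines 8 8) (a b : nat) (m : mines a b) : bool :=
  [exists i : 'I_a, exists j : 'I_b,
    [&& (i + 8 <= a)%N, (j + 8 <= b)%N & subgrid m i j == p]].

Definition has_pattern (a b : nat) (m : mines a b) : bool :=
  occurs P1 m || occurs P2 m.

(* Transition probability from m to m': a cell c, uniform among the empty cells
   of m, receives a mine. *)
Definition mine_step (R : realType) (a b : nat) (m m' : mines a b) : R :=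
  \sum_(c in ~: m) (c |: m == m')%:R / #|~: m|%:R.

(* M is (a version of) the random mine process on the a x b grid, described by
   its joint law at the times 0, ..., a * b: conditionally on the history up to
   time t, the next state is distributed according to mine_step.
   The values M t for t > a * b are irrelevant. *)
Definition mine_process (R : realType) (d : measure_display)
    (T : measurableType d) (P : probability T R) (a b : nat)
    (M : nat -> T -> mines a b) : Prop :=
  [/\ forall t m, (t <= a * b)%N -> measurable [set w | M t w = m]%classic,
      P [set w | M 0%N w = finset.set0]%classic = 1%E
    & forall (t : nat) (x : nat -> mines a b), (t < a * b)%N ->
        P [set w | forall s, (s <= t.+1)%N -> M s w = x s]%classic =
        (P [set w | forall s, (s <= t)%N -> M s w = x s]%classic *
         (mine_step R (x t) (x t.+1))%:E)%E].

(* First time at which the trajectory x contains one of the two patterns;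
   None stands for an infinite time. *)
Definition tau (a b : nat) (x : nat -> mines a b) : option nat :=
  ohead [seq t <- iota 0 (a * b).+1 | has_pattern (x t)].

Definition cond_prob (R : realType) (d : measure_display)
    (T : measurableType d) (P : probability T R) (A B : set T) : R :=
  fine (P (A `&` B)%classic) / fine (P B).

(* The event { tau < n^0.9 and M^tau = m }, with n = a * b. *)
Definition early_first_occurrence (R : realType) (T : Type) (a b : nat)
    (M : nat -> T -> mines a b) (m : mines a b) : set T :=
  [set w | exists t : nat, [/\ tau (M^~ w) = Some t,
     t%:R < (a * b)%N%:R `^ (9 / 10) :> R & M t w = m]]%classic.

(* The event { for all tau < t < n/2, M^t contains P1 or P2 }, with n = a * b. *)
Definition pattern_persists (R : realType) (T : Type) (a b : nat)
    (M : nat -> T -> mines a b) : set T :=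
  [set w | forall s t : nat, tau (M^~ w) = Some s -> (s < t)%N ->
     t%:R < (a * b)%N%:R / 2 :> R -> has_pattern (M t w)]%classic.

(* Main.v *)
Require Import Defs.
From HB Require Import structures.
From mathcomp Require Import all_boot all_order all_algebra.
From mathcomp Require Import zify ring lra.

Set Implicit Arguments.
Unset Strict Implicit.
Unset Printing Implicit Defensive.

(* Let m be the state at time tau, n = a * b the number of cells and K a large
   constant depending only on eps. Given m, later states are uniform among the
   supersets of m of the right size.

   Up to time n / K the occurrence already present in m survives unless one of
   the at most 64 cells of its window is hit, which has probability at most
   128 / K. This event is read off the state at time n / K alone because the
   process is increasing.

   Now fix a time between n / K and n / 2. As m has only tau = o(n) mines, at
   least n / (512 K) disjoint windows contain no mine of m. Exposing them one by
   one, each coincides with P1 with conditional probability at least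
   (4 K) ^ (-64), so that none of them does with probability exponentially small
   in n, which absorbs a union bound over the times. *)

(** * Binomial estimates and counting of [k]-subsets *)

(** Removing one point of the ground set costs a factor [x / k] if the point is drawn and
    [x / (x - k)] if it is not. The margin [w] in the hypotheses keeps both ratios at most [A]
    during [w] removals. *)
Lemma leq_bin_sub A w q x k : q <= w -> 0 < x ->
  x <= A * (k - w) -> x <= A * (x - k - w) ->
  'C(x, k) <= A ^ w * 'C(x - w, k - q).
Proof.
elim: w q x k => [|w IHw] q x k.
  by rewrite leqn0 => /eqP-> _ _ _; rewrite expn0 mul1n !subn0.
move=> leqw x_gt0 lexk lexxk.
have k_gt : w.+1 < k.
  by rewrite -subn_gt0; move: (leq_trans x_gt0 lexk); rewrite muln_gt0 => /andP[].
have x_gt : w.+1 + k < x.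
  move: (leq_trans x_gt0 lexxk); rewrite muln_gt0 => /andP[_]; lia.
have stepl : 'C(x, k) <= A * 'C(x.-1, k.-1).
  case: x k x_gt0 k_gt x_gt lexk {lexxk} => // x [|k] // _ k_gt x_gt lexk.
  have h := mul_bin_diag x.+1 k; rewrite !succnK in h *.
  have : x.+1 <= A * k.+1 by apply: leq_trans lexk _; rewrite leq_mul2l; lia.
  move=> hA; rewrite -(leq_pmul2l (ltn0Sn k)) -h; nia.
have stepr : 'C(x, k) <= A * 'C(x.-1, k).
  have h := mul_bin_down x k.
  have hx : x <= A * (x - k) by apply: leq_trans lexxk _; rewrite leq_mul2l; lia.
  have xk : 0 < x - k by lia.
  rewrite -(leq_pmul2l xk) -h; nia.
case: q leqw => [|q] leqw.
  apply: leq_trans stepr _; rewrite expnS -mulnA leq_mul2l.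
  have := IHw 0 x.-1 k isT; rewrite !subn0.
  have -> : x - w.+1 = x.-1 - w by lia.
  move=> ->; rewrite ?orbT //; first lia.
    by apply: leq_trans (leq_trans _ lexk) _; [lia | rewrite leq_mul2l; lia].
  by apply: leq_trans (leq_trans _ lexxk) _; [lia | rewrite leq_mul2l; lia].
apply: leq_trans stepl _; rewrite expnS -mulnA leq_mul2l.
have := IHw q x.-1 k.-1 leqw.
have -> : x - w.+1 = x.-1 - w by lia.
have -> : k - q.+1 = k.-1 - q by lia.
move=> ->; rewrite ?orbT //; first lia.
  by apply: leq_trans (leq_trans _ lexk) _; [lia | rewrite leq_mul2l; lia].
by apply: leq_trans (leq_trans _ lexxk) _; [lia | rewrite leq_mul2l; lia].
Qed.

Section Draws.
Variable T : finType.
Implicit Types (X W Q S D : {set T}) (k : nat) (B : pred {set T}).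

(** Divided by ['C(#|X|, k)], this is the probability of [B] for a uniform [k]-subset of [X]. *)
Definition draws X k B :=
  #|[set S : {set T} | [&& S \subset X, #|S| == k & B S]]|.

(** Conditioning on the trace [D] of the drawn set on [W]. Without the bound [#|D| <= k], the
    truncated [k - #|D|] would be 0 and let in a spurious empty set. *)
Lemma draws_split X W k B : W \subset X ->
  draws X k B = \sum_(D : {set T} | (D \subset W) && (#|D| <= k))
                   draws (X :\: W) (k - #|D|) (fun S => B (D :|: S)).
Proof.
move=> sWX; rewrite /draws -sum1_card.
rewrite (partition_big (fun S => S :&: W)
           (fun D => (D \subset W) && (#|D| <= k))); last first.
  move=> S; rewrite inE => /and3P[_ /eqP <- _].
  by rewrite subsetIr subset_leq_card ?subsetIl.
apply: eq_bigr => D /andP[sDW leDk]; rewrite -sum1_card.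
have dis S : S \subset X :\: W -> [disjoint S & W].
  by rewrite subsetD => /andP[].
rewrite (reindex_onto (fun S => D :|: S) (fun S => S :\: W)) /=; last first.
  by move=> S /andP[_ /eqP <-]; rewrite setID.
apply: eq_bigl => S; rewrite !inE.
have -> : ((D :|: S) :\: W == S) = [disjoint S & W].
  rewrite setDUl (eqP (_ : D :\: W == set0)) ?setD_eq0 // set0U.
  by apply/eqP/setDidPl.
have [dSW|ndSW] := boolP [disjoint S & W]; last first.
  rewrite andbF; apply/esym/negbTE; apply: contra ndSW.
  by case/and3P => /dis.
rewrite andbT.
have SW0 : S :&: W = set0 by apply/disjoint_setI0.
rewrite setIUl SW0 setU0 (setIidPl sDW) eqxx andbT.
have -> : #|D :|: S| = #|D| + #|S|.
  rewrite cardsU (_ : D :&: S = set0) ?cards0 ?subn0 //.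
  by apply/eqP; rewrite -subset0 -SW0 setIC setIS.
rewrite subUset (subset_trans sDW sWX) subsetD dSW andbT /=.
by congr [&& _, _ & _]; apply/eqP/eqP; lia.
Qed.

Lemma draws_card X k : draws X k xpredT = 'C(#|X|, k).
Proof.
by rewrite -cards_draws /draws; apply: eq_card => S; rewrite !inE andbT.
Qed.

Implicit Type ws : seq ({set T} * {set T}).

(* In a pair (W, Q) of ws, Q is the forbidden content of the window W. *)
Definition misses ws : pred {set T} :=
  fun S => all (fun wq => S :&: wq.1 != wq.2) ws.

(* Expose the windows one after the other: whatever the earlier ones contain,
   leq_bin_sub bounds below by 1 / A ^ w the chance that the next one contains
   exactly Q. *)
Lemma draws_misses A w ws X k : 0 < #|X| ->
  all (fun wq : {set T} * {set T} =>
    [&& wq.1 \subset X, wq.2 \subset wq.1 & #|wq.1| <= w]) ws ->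
  pairwise (fun u v : {set T} * {set T} => [disjoint u.1 & v.1]) ws ->
  #|X| <= A * (k - w * size ws) -> #|X| <= A * (#|X| - k - w * size ws) ->
  draws X k (misses ws) * (A ^ w) ^ size ws
    <= (A ^ w).-1 ^ size ws * 'C(#|X|, k).
Proof.
elim: ws X k => [|[W Q] ws IHws] X k X_gt0.
  move=> _ _ _ _; rewrite !expn0 muln1 mul1n -draws_card.
  by apply/subset_leq_card/subsetP => S; rewrite !inE.
move=> /= /andP[/and3P[sWX sQW leWw] wsP] /andP[disW pw] lek lexk.
set s := size ws in IHws lek lexk *.
have k_gt : w * s.+1 < k.
  by rewrite -subn_gt0; move: (leq_trans X_gt0 lek); rewrite muln_gt0 => /andP[].
have x_gt : w * s.+1 + k < #|X|.
  move: (leq_trans X_gt0 lexk); rewrite muln_gt0 => /andP[_]; lia.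
have cX' : #|X :\: W| = #|X| - #|W| by rewrite cardsD (setIidPr sWX).
have leD D : D \subset W -> #|D| <= w.
  by move=> sDW; apply: leq_trans leWw; apply: subset_leq_card.
have A_gt0 : 0 < A by move: (leq_trans X_gt0 lek); rewrite muln_gt0 => /andP[].
have IH D : D \subset W ->
  draws (X :\: W) (k - #|D|) (misses ws) * (A ^ w) ^ s
    <= (A ^ w).-1 ^ s * 'C(#|X :\: W|, k - #|D|).
  move=> sDW; have Dw := leD _ sDW; apply: IHws => //; rewrite ?cX'.
  - nia.
  - apply/allP => -[W' Q'] /[dup] h /(allP wsP) /= /and3P[s1 -> ->].
    by rewrite subsetD s1 disjoint_sym (allP disW _ h).
  - apply: (leq_trans (leq_subr _ _) (leq_trans lek _)).
    by rewrite leq_mul2l mulnS; lia.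
  - apply: (leq_trans (leq_subr _ _) (leq_trans lexk _)).
    by rewrite leq_mul2l mulnS; lia.
(* The margin in the hypotheses gives [w < k], so the size condition of [draws_split] is
   automatic. *)
have allk : (fun D => (D \subset W) && (#|D| <= k)) =1 (fun D => D \subset W).
  move=> D; have [/leD|//] := boolP (D \subset W); nia.
(* The trace [Q] is excluded; any other trace [D] leaves the event on the later windows unchanged,
   as these are disjoint from [W]. *)
have -> : draws X k (misses ((W, Q) :: ws)) =
  \sum_(D : {set T} | (D \subset W) && (D != Q))
     draws (X :\: W) (k - #|D|) (misses ws).
  rewrite (draws_split _ _ sWX) (eq_bigl _ _ allk) (bigID (fun D => D == Q)) /=.
  rewrite [X in X + _]big1 ?add0n => [|D /andP[sDW /eqP->]].
    apply: eq_bigr => D /andP[sDW nDQ]; apply: eq_card => S; rewrite !inE.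
    have [sSX|//] := boolP (S \subset _); congr (_ && _).
    have SW0 : S :&: W = set0.
      by apply/disjoint_setI0; move: sSX; rewrite subsetD => /andP[].
    rewrite setIUl SW0 setU0 (setIidPl sDW) nDQ /= /misses.
    congr (_ && _); apply: eq_in_all => -[W' Q'] /(allP disW) /= dWW'.
    rewrite setIUl (_ : D :&: W' = set0) ?set0U //.
    by apply/disjoint_setI0; apply: disjointWl dWW'.
  apply/eqP; rewrite cards_eq0; apply/eqP/setP => S; rewrite !inE.
  have [sSX|//] := boolP (S \subset _).
  have SW0 : S :&: W = set0.
    by apply/disjoint_setI0; move: sSX; rewrite subsetD => /andP[].
  by rewrite setIUl SW0 setU0 (setIidPl sQW) eqxx andbF.
have tot : 'C(#|X|, k) = 'C(#|X :\: W|, k - #|Q|) +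
  \sum_(D : {set T} | (D \subset W) && (D != Q)) 'C(#|X :\: W|, k - #|D|).
  rewrite -draws_card (draws_split _ _ sWX) (eq_bigl _ _ allk).
  rewrite (bigD1 Q) //= draws_card; congr (_ + _).
  by apply: eq_bigr => D _; rewrite draws_card.
have lecC : 'C(#|X|, k) <= A ^ w * 'C(#|X :\: W|, k - #|Q|).
  apply: (@leq_trans (A ^ #|W| * 'C(#|X| - #|W|, k - #|Q|))).
    apply: leq_bin_sub => //; first exact: subset_leq_card.
      by apply: leq_trans lek _; rewrite leq_mul2l mulnS; lia.
    by apply: leq_trans lexk _; rewrite leq_mul2l mulnS; lia.
  by rewrite cX' leq_mul2r leq_pexp2l ?orbT.
set c := A ^ w in IH lecC *.
have c_gt0 : 0 < c by rewrite expn_gt0 A_gt0.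
rewrite !expnS mulnCA -mulnA.
set Z := \sum_(D | _) 'C(_, _) in tot.
apply: (@leq_trans (c * (c.-1 ^ s * Z))).
  rewrite leq_mul2l /Z big_distrl big_distrr /=; apply/orP; right.
  by apply: leq_sum => D /andP[sDW _]; apply: IH.
rewrite mulnCA [leqRHS]mulnCA leq_mul2l; apply/orP; right.
(* With [q] for the term of [Q], [q + Z <= c * q] gives [Z <= c.-1 * q], which is equivalent to
   [c * Z <= c.-1 * (q + Z)]. *)
move: lecC; rewrite tot; case: (c) c_gt0 => // e _; rewrite succnK; nia.
Qed.

(** Brings the states reachable from [m] in [k] steps to the form of a draw from the empty cells, to
    which the previous bounds apply. *)
Lemma card_supersets (m : {set T}) k B :
  #|[set S : {set T} | [&& m \subset S, #|S| == #|m| + k & B S]]|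
    = draws (~: m) k (fun S => B (m :|: S)).
Proof.
rewrite /draws -[LHS]sum1_card -[RHS]sum1_card.
rewrite (reindex_onto (fun S => m :|: S) (fun S => S :\: m)) /=; last first.
  by move=> S; rewrite inE => /and3P[/setIidPr h _ _]; rewrite -{1}h setID.
apply: eq_bigl => S; rewrite !inE subsetUl /=.
have -> : ((m :|: S) :\: m == S) = (S \subset ~: m).
  by rewrite setDUl setDv set0U -disjoints_subset; apply/eqP/setDidPl.
rewrite andbC; have [sS|//] := boolP (S \subset _).
congr (_ && _); rewrite cardsU (_ : m :&: S = set0) ?cards0 ?subn0 ?eqn_add2l //.
by apply/disjoint_setI0; rewrite disjoint_sym disjoints_subset.
Qed.

Lemma draws_mem X k (c : T) : c \in X ->
  draws X k.+1 (fun S : {set T} => c \in S) = 'C(#|X|.-1, k).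
Proof.
move=> cX; have sc : [set c] \subset X by rewrite sub1set.
rewrite (draws_split _ _ sc) (bigD1 [set c]) /= ?cards1 ?subxx //.
rewrite big1 ?addn0 => [|D /andP[/andP[sD _] nD]].
  rewrite subn1 succnK (_ : #|X|.-1 = #|X :\: [set c]|); last first.
    by rewrite cardsD (setIidPr sc) cards1 subn1.
  rewrite -draws_card; apply: eq_card => S; rewrite !inE eqxx /=.
  by [].
move: sD; rewrite subset1 (negbTE nD) /= => /eqP ->.
apply/eqP; rewrite cards_eq0; apply/eqP/setP => S; rewrite !inE /=.
apply/negbTE/negP => /and3P[/subsetP h _ cS].
by have := h _ cS; rewrite !inE eqxx.
Qed.

(** Union bound over the points of [W]: each is drawn with probability [k / #|X|], or never if it
    lies outside [X]. *)
Lemma draws_hit X W k w : #|W| <= w ->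
  draws X k (fun S => ~~ [disjoint S & W]) * #|X| <= w * k * 'C(#|X|, k).
Proof.
move=> Ww; case: k => [|k].
  rewrite [X in X * _](_ : _ = 0) ?mul0n //.
  apply/eqP; rewrite cards_eq0; apply/eqP/setP => S; rewrite !inE /= cards_eq0.
  by apply/negbTE/negP => /and3P[_ /eqP -> /negP[]]; rewrite -setI_eq0 set0I.
rewrite -mulnA -mul_bin_diag [leqRHS]mulnCA [leqLHS]mulnC leq_mul2l; apply/orP; right.
apply: (@leq_trans (\sum_(c in W) draws X k.+1 (fun S : {set T} => c \in S))).
  rewrite /draws.
  under [leqRHS]eq_bigr => c _ do rewrite -sum1_card.
  rewrite (exchange_big_dep (mem [set S : {set T} |
    [&& S \subset X, #|S| == k.+1 & true]])) /=; last first.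
    by move=> c S _; rewrite !inE => /and3P[-> ->].
  rewrite -sum1_card [leqRHS](bigID (fun S : {set T} => ~~ [disjoint S & W])) /=.
  apply: leq_trans (leq_addr _ _).
  rewrite [leqRHS](eq_bigl (mem [set S : {set T} |
    [&& S \subset X, #|S| == k.+1 & ~~ [disjoint S & W]]])); last first.
    by move=> S; rewrite !inE andbT -andbA.
  apply: leq_sum => S; rewrite inE => /and3P[sS cS].
  rewrite -setI_eq0 => /set0Pn[c]; rewrite inE => /andP[cS' cW].
  by rewrite (bigD1 c) //= cW inE sS cS.
apply: (@leq_trans (\sum_(c in W) 'C(#|X|.-1, k))); last first.
  by rewrite sum_nat_const leq_mul2r Ww orbT.
apply: leq_sum => c cW; have [cX|cX] := boolP (c \in X).
  by rewrite draws_mem.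
rewrite [X in X <= _](_ : _ = 0) //.
apply/eqP; rewrite cards_eq0; apply/eqP/setP => S; rewrite !inE /=.
by apply/negbTE/negP => /and3P[/subsetP h _ /h]; rewrite (negbTE cX).
Qed.

End Draws.

(** * Geometry of the 8 x 8 windows *)

Section Windows.
Variables a b : nat.

(** An embedding that carries the proofs that the window fits, so that [subgrid], defined through
    integer coordinates, becomes a preimage. *)
Definition window i j (hi : i + 8 <= a) (hj : j + 8 <= b) (u : cell 8 8) :
  cell a b := (widen_ord hi (rshift i u.1), widen_ord hj (rshift j u.2)).

Section OneWindow.
Variables (i j : nat) (hi : i + 8 <= a) (hj : j + 8 <= b).

Lemma window_inj : injective (window hi hj).
Proof.
move=> [u1 u2] [v1 v2] [] /eqP; rewrite eqn_add2l => /eqP/val_inj ->.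
by move=> /eqP; rewrite eqn_add2l => /eqP/val_inj ->.
Qed.

Lemma subgridE (m : mines a b) :
  subgrid m i j = [set u | window hi hj u \in m].
Proof.
apply/setP => u; rewrite !inE; apply/existsP/idP => [[c]|wm].
  case/and3P => cm /eqP h1 /eqP h2; rewrite (_ : window _ _ u = c) //.
  by case: c {cm} h1 h2 => c1 c2 /= h1 h2; congr pair; apply: val_inj.
by exists (window hi hj u); rewrite wm !eqxx.
Qed.

Lemma subgrid_capset (W m S : mines a b) : W = window hi hj @: [set: cell 8 8] ->
  S :&: W = m :&: W -> subgrid S i j = subgrid m i j.
Proof.
move=> WE SW; rewrite !subgridE; apply/setP => u; rewrite !inE.
have uW : window hi hj u \in W by rewrite WE imset_f.
by move/setP: SW => /(_ (window hi hj u)); rewrite !inE uW !andbT.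
Qed.

Lemma subgrid_imset (p : mines 8 8) : subgrid (window hi hj @: p) i j = p.
Proof.
by rewrite subgridE; apply/setP => u; rewrite inE mem_imset //; apply: window_inj.
Qed.

Lemma subgrid_occurs p (m : mines a b) : subgrid m i j = p -> occurs p m.
Proof.
move=> /eqP mp; have ia : i < a by lia.
have jb : j < b by lia.
apply/existsP; exists (Ordinal ia); apply/existsP; exists (Ordinal jb).
by rewrite /= hi hj.
Qed.

Lemma card_window : #|window hi hj @: [set: cell 8 8]| <= 64.
Proof.
by apply: leq_trans (leq_imset_card _ _) _; rewrite cardsT card_prod !card_ord.
Qed.

End OneWindow.

(** [W] is the window of one occurrence in [m]: this occurrence is lost only if some cell of [W]
    changes. *)
Lemma pattern_window (m : mines a b) : has_pattern m ->
  exists2 W : mines a b, #|W| <= 64 &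
    forall S : mines a b, S :&: W = m :&: W -> has_pattern S.
Proof.
have H p : occurs p m -> exists2 W : mines a b, #|W| <= 64 &
    forall S : mines a b, S :&: W = m :&: W -> occurs p S.
  case/existsP => i /existsP[j /and3P[hi hj /eqP mp]].
  exists (window hi hj @: [set: cell 8 8]); first exact: card_window.
  move=> S SW; apply: (subgrid_occurs hi hj).
  by rewrite (subgrid_capset _ SW).
by case/orP => /H[W W64 hW]; exists W => // S /hW oS; rewrite /has_pattern oS ?orbT.
Qed.

(** Tile the grid by aligned windows: each mine of [m] spoils at most one tile, so [L] clean tiles
    remain. Forbidding [P1] in each of them is all that is kept from the absence of both
    patterns. *)
Lemma clean_windows (m : mines a b) L : L + #|m| <= (a %/ 8) * (b %/ 8) ->
  exists ws : seq (mines a b * mines a b),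
    [/\ size ws = L,
        all (fun wq : {set cell a b} * {set cell a b} =>
          [&& wq.1 \subset ~: m, wq.2 \subset wq.1 & #|wq.1| <= 64]) ws,
        pairwise (fun u v : {set cell a b} * {set cell a b} =>
          [disjoint u.1 & v.1]) ws
      & forall S, ~~ has_pattern (m :|: S) -> misses ws S].
Proof.
move=> hL; pose I := ('I_(a %/ 8) * 'I_(b %/ 8))%type.
have corner (x : nat) (k : 'I_(x %/ 8)) : k * 8 + 8 <= x.
  by have := ltn_ord k; lia.
pose win (k : I) := window (corner a k.1) (corner b k.2).
pose W k : {set cell a b} := win k @: [set: cell 8 8].
pose Q k : {set cell a b} := win k @: P1.
(* Division by 8 recovers the index of a tile from any of its cells, whence disjointness. *)
have inW c k : c \in W k -> (k.1 = c.1 %/ 8 :> nat) /\ (k.2 = c.2 %/ 8 :> nat).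
  by case/imsetP => -[u1 u2] _ -> /=; have := ltn_ord u1; have := ltn_ord u2; lia.
have W_inj c k k' : c \in W k -> c \in W k' -> k = k'.
  move=> /inW[h1 h2] /inW[h1' h2']; case: k k' h1 h2 h1' h2' => k1 k2 [k1' k2'] /=.
  by move=> h1 h2 h1' h2'; congr pair; apply: val_inj; rewrite /= ?h1 ?h2.
pose A := [set k | [disjoint W k & m]].
have cA : L <= #|A|.
  have : #|A| + #|~: A| = (a %/ 8) * (b %/ 8) by rewrite cardsC card_prod !card_ord.
  suff : #|~: A| <= #|m| by lia.
  (* Choosing a mine in each spoiled tile is injective, since tiles are disjoint. *)
  pose f k : option (cell a b) := [pick c in W k :&: m].
  have fP k : k \in ~: A -> exists c, [/\ f k = Some c, c \in W k & c \in m].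
    rewrite !inE -setI_eq0 /f; case: pickP => [c|h0 /set0Pn[c]].
      by rewrite inE => /andP[]; exists c.
    by rewrite h0.
  have f_inj : {in ~: A &, injective f}.
    move=> k k' /fP[c [-> kc _]] /fP[c' [-> kc' _]] [cc'].
    by apply: W_inj kc _; rewrite cc'.
  rewrite -(card_in_imset f_inj) -[#|m|](card_imset _ (@Some_inj _)).
  apply/subset_leq_card/subsetP => _ /imsetP[k /fP[c [fk _ cm]] ->].
  by rewrite fk imset_f.
exists [seq (W k, Q k) | k <- take L (enum A)].
have tA k : k \in take L (enum A) -> [disjoint W k & m].
  by move/mem_take; rewrite mem_enum inE.
split.
- by rewrite size_map size_takel // -cardE.
- apply/allP => _ /mapP[k /tA dk ->] /=.
  by rewrite -disjoints_subset dk card_window imsetS ?subsetT.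
- rewrite pairwise_map.
  have := take_uniq L (enum_uniq A).
  rewrite uniq_pairwise; apply: sub_pairwise => k k' /= kk'.
  rewrite -setI_eq0; apply/set0Pn => -[c]; rewrite inE => /andP[ck ck'].
  by case/eqP: kk'; apply: W_inj ck ck'.
- move=> S npS; apply/allP => _ /mapP[k /tA dk ->] /=.
  apply: contra npS => /eqP SW.
  rewrite /has_pattern (@subgrid_occurs _ _ (corner a k.1) (corner b k.2)) //.
  rewrite -[RHS](subgrid_imset (corner a k.1) (corner b k.2)).
  apply: (@subgrid_capset _ _ _ _ (W k)) => //.
  rewrite setIUl SW setIC (disjoint_setI0 dk) set0U.
  by apply/esym/setIidPl/imsetS/subsetT.
Qed.

End Windows.

(** * The [k]-step transition kernel *)

Import Order.TTheory GRing.Theory Num.Theory.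
Local Open Scope ring_scope.

(** The law of the state [k] steps after [m], in closed form. *)
Definition transition (R : realFieldType) (T : finType) (k : nat)
    (m m' : {set T}) : R :=
  ((m \subset m') && (#|m'| == #|m| + k)%N)%:R / 'C(#|~: m|, k)%:R.

(** Chapman-Kolmogorov. An admissible [m'] is reached through [k.+1] intermediate sets, one for each
    choice of the last new element, each contributing [1 / ('C(N, k) * (N - k))]; and
    ['C(N, k) * (N - k) = k.+1 * 'C(N, k.+1)]. *)
Lemma transition_comp (R : realFieldType) (T : finType) (k : nat)
    (m m' : {set T}) :
  \sum_m1 transition R k m m1 * transition R 1 m1 m' = transition R k.+1 m m'.
Proof.
pose N := #|~: m|.
have cT : #|T| = (#|m| + N)%N by rewrite /N cardsC.
pose A := [set m1 : {set T} | [&& m \subset m1, #|m1| == #|m| + k & m1 \subset m']]%N.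
rewrite {3}/transition.
case: (boolP (_ && _)) => [/andP[sm /eqP cm]|nm]; last first.
  rewrite mul0r big1 // => m1 _; rewrite /transition.
  case: (boolP (_ && _)) => [/andP[s1 /eqP c1]|_]; last by rewrite !mul0r.
  case: (boolP (_ && _)) => [/andP[s2 /eqP c2]|_]; last by rewrite !mul0r mulr0.
  by case/negP: nm; rewrite (subset_trans s1 s2) c2 c1 addn1 addnS eqxx.
have cA : #|A| = k.+1.
  rewrite /A (card_supersets _ _ (fun m1 => m1 \subset m')).
  rewrite (_ : draws _ _ _ = 'C(#|m' :\: m|, k)).
    by rewrite cardsD (setIidPr sm) cm addKn binSn.
  rewrite -cards_draws /draws; apply: eq_card => S; rewrite !inE.
  rewrite subUset sm subsetD disjoints_subset /=.
  by case: (S \subset m'); case: (S \subset ~: m); case: (_ == _).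
have lekN : (k < N)%N.
  have := subset_leq_card (subsetT m'); rewrite cardsT cm cT; lia.
transitivity (\sum_(m1 in A) ('C(N, k)%:R * (N - k)%:R)^-1 : R).
  rewrite [RHS]big_mkcond; apply: eq_bigr => m1 _; rewrite /transition inE.
  case: (boolP (m \subset m1)) => s1 /=; last by rewrite !mul0r.
  case: eqP => c1 /=; last by rewrite !mul0r.
  rewrite cm c1 addn1 addnS eqxx andbT.
  case: (boolP (m1 \subset m')) => s2 /=; last by rewrite mul0r mulr0.
  have -> : #|~: m1| = (N - k)%N.
    by have := cardsC m1; rewrite c1 cT; lia.
  by rewrite bin1 !mul1r invfM.
rewrite sumr_const cA -[LHS]mulr_natl -!natrM mul1r.
have bnz : ('C(N, k.+1)%:R : R) != 0 by rewrite pnatr_eq0 -lt0n bin_gt0.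
have knz : (k.+1%:R : R) != 0 by rewrite pnatr_eq0.
by rewrite mulnC -mul_bin_left natrM invfM mulVKf.
Qed.

(** * Markov property and survival bound for a law on finite paths *)

Section PathLaw.
Variables (R : realFieldType) (T : finType) (n : nat).
Let Omega := {ffun 'I_n.+1 -> {set T}}.
Variable p : Omega -> R.

(** Times stay plain integers; beyond [n], [inord] falls back to time 0, hence the side conditions
    [t <= n]. *)
Definition at_time (f : Omega) (t : nat) : {set T} := f (inord t).

Definition agree t (f g : Omega) : bool :=
  [forall i : 'I_n.+1, (i <= t)%N ==> (f i == g i)].

Definition pr (A : pred Omega) : R := \sum_(f | A f) p f.

(** Membership in the sigma-algebra of the history up to time [t]. *)
Definition past t (A : pred Omega) :=
  forall f g : Omega, agree t f g -> A f = A g.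

Hypothesis p_ge0 : forall f, 0 <= p f.
Hypothesis p_start : pr (fun f => at_time f 0 != set0) = 0.
Hypothesis p_step : forall t g, (t < n)%N ->
  pr (agree t.+1 ^~ g) =
  pr (agree t ^~ g) * transition R 1 (at_time g t) (at_time g t.+1).

Lemma agreeP t (f g : Omega) :
  reflect (forall s, (s <= t)%N -> (s <= n)%N -> at_time f s = at_time g s)
          (agree t f g).
Proof.
apply: (iffP forallP) => [h s st sn|h i].
  by have := h (inord s); rewrite inordK // st => /eqP.
apply/implyP => it; apply/eqP.
by have := h i it (leq_ord i); rewrite /at_time inord_val.
Qed.

Lemma pr_ge0 A : 0 <= pr A.
Proof. exact: sumr_ge0. Qed.

Lemma pr_ext (A B : pred Omega) : A =1 B -> pr A = pr B.
Proof. by move=> AB; apply: eq_bigl. Qed.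

Lemma pr_part (A : pred Omega) (K : finType) (h : Omega -> K) :
  pr A = \sum_k pr (fun f => A f && (h f == k)).
Proof. by rewrite /pr (partition_big h xpredT). Qed.

Lemma pr_union (A : pred Omega) (I : eqType) (r : seq I) (B : I -> pred Omega) :
  (forall f, A f -> exists2 i, i \in r & B i f) ->
  pr A <= \sum_(i <- r) pr (B i).
Proof.
move=> AB; rewrite /pr (exchange_big_dep xpredT) //= big_mkcond.
apply: ler_sum => f _; case: ifP => [/AB[i ir Bi]|_]; last exact: sumr_ge0.
rewrite (big_rem i) //= Bi lerDl; exact: sumr_ge0.
Qed.

Lemma pr_le (A B : pred Omega) : (forall f, A f -> B f) -> pr A <= pr B.
Proof.
move=> AB; have := @pr_union A _ [:: tt] (fun=> B); rewrite big_seq1; apply.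
by move=> f /AB Bf; exists tt; rewrite ?mem_head.
Qed.

(** [p_step] speaks of complete histories; [A] is a union of such histories, over which it is
    summed. *)
Lemma markov t (A : pred Omega) m m' : (t < n)%N -> past t A ->
  pr (fun f => [&& A f, at_time f t == m & at_time f t.+1 == m']) =
  pr (fun f => A f && (at_time f t == m)) * transition R 1 m m'.
Proof.
move=> tn pA.
(* [h f] encodes the history of [f] up to [t]. With the padding [m'], agreeing with [h f] up to
   [t.+1] means having this history and then the state [m']. *)
pose h (f : Omega) : Omega := [ffun i : 'I_n.+1 => if (i <= t)%N then f i else m'].
have at_h f s : (s <= n)%N -> at_time (h f) s = if (s <= t)%N then at_time f s else m'.
  by move=> sn; rewrite /at_time ffunE inordK.
have hK f : agree t f (h f).
  by apply/agreeP => s st sn; rewrite at_h // st.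
rewrite (pr_part _ h) [in RHS](pr_part _ h) mulr_suml; apply: eq_bigr => g _.
have h_eq f : (h f == g) = agree t f g && (h g == g).
  apply/eqP/andP => [<-|[fg /eqP <-]].
    split=> //; apply/eqP/ffunP => i; rewrite !ffunE.
    by case: ifP => // ->.
  apply/ffunP => i; rewrite !ffunE; case: ifP => // it.
  by move/forallP: fg => /(_ i); rewrite it => /eqP.
case: (boolP [&& A g, at_time g t == m & h g == g]) => [/and3P[Ag /eqP gm /eqP hg]|ng].
  have g1 : at_time g t.+1 = m' by rewrite -hg at_h // ltnn.
  rewrite (@pr_ext _ (agree t.+1 ^~ g)); last first.
    move=> f; rewrite h_eq hg eqxx andbT.
    apply/andP/agreeP => [[/and3P[_ _ /eqP f1] /agreeP fg] s st sn|fg].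
      move: st; rewrite leq_eqVlt => /predU1P[->|/fg]; first by rewrite f1 g1.
      exact.
    have fg' : agree t f g by apply/agreeP => s st sn; apply: fg => //; lia.
    by split=> //; rewrite (pA _ _ fg') Ag !fg ?gm ?g1 ?eqxx //; apply: ltnW.
  rewrite p_step // gm g1; congr (_ * _); apply: pr_ext => f.
  rewrite h_eq hg eqxx andbT; apply/idP/andP => [fg|[]//].
  split=> //; rewrite (pA _ _ fg) Ag; move/agreeP: fg => -> //; last exact: ltnW.
  by rewrite gm eqxx.
(* Here [g] encodes no history or one outside the event, and both sums are empty. *)
rewrite [X in X * _]big_pred0 ?mul0r ?[LHS]big_pred0 // => f;
  apply/negbTE; apply: contra ng.
  rewrite (h_eq f); case/andP => /and3P[Af /eqP fm _] /andP[fg ->].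
  rewrite -(pA _ _ fg) Af -fm; move/agreeP: fg => ->; rewrite ?eqxx //.
  exact: ltnW.
rewrite (h_eq f); case/andP => /andP[Af /eqP fm] /andP[fg ->].
rewrite -(pA _ _ fg) Af -fm; move/agreeP: fg => ->; rewrite ?eqxx //.
exact: ltnW.
Qed.

Lemma pr_trans s (A : pred Omega) m k m' : past s A -> (s + k <= n)%N ->
  pr (fun f => [&& A f, at_time f s == m & at_time f (s + k) == m']) =
  pr (fun f => A f && (at_time f s == m)) * transition R k m m'.
Proof.
move=> pA; elim: k m' => [|k IHk] m' skn.
  rewrite addn0 /transition addn0 bin0 divr1.
  have -> : (m \subset m') && (#|m'| == #|m|) = (m == m').
    rewrite eqEcard; apply: andb_id2l => /subset_leq_card mm'.
    by rewrite eqn_leq mm' andbT.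
  case: eqP => [<-|mm']; rewrite ?mulr1 ?mulr0.
    by apply: pr_ext => f; rewrite /= andbb.
  apply: big_pred0 => f; case: eqP => [->|]; rewrite ?andbF //.
  by rewrite (introF eqP mm') !andbF.
rewrite (pr_part _ (fun f => at_time f (s + k))) -transition_comp mulr_sumr.
apply: eq_bigr => m1 _; rewrite mulrA -IHk; last by lia.
have sk : (s + k < n)%N by lia.
have pA' : past (s + k) (fun f => A f && (at_time f s == m)).
  move=> f g fg; have fg' : agree s f g.
    by apply/agreeP => i it; move/agreeP: fg; apply; lia.
  by rewrite (pA _ _ fg'); congr (_ && _); move/agreeP: fg => -> //; lia.
rewrite addnS; transitivity (pr (fun f => [&& A f && (at_time f s == m),
    at_time f (s + k) == m1 & at_time f (s + k).+1 == m'])).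
  by apply: pr_ext => f; rewrite -!andbA; congr [&& _, _ & _]; rewrite andbC.
rewrite markov //; congr (_ * _); apply: pr_ext => f.
by rewrite -andbA.
Qed.

(** The link with counting: conditional probabilities of later states are quotients of [draws] by
    binomials. *)
Lemma pr_trans_pred s (A : pred Omega) m k (B : pred {set T}) :
  past s A -> (s + k <= n)%N ->
  pr (fun f => [&& A f, at_time f s == m & B (at_time f (s + k))]) =
  pr (fun f => A f && (at_time f s == m)) *
    ((draws (~: m) k (fun S => B (m :|: S)))%:R / 'C(#|~: m|, k)%:R).
Proof.
move=> pA skn; rewrite (pr_part _ (fun f => at_time f (s + k))).
rewrite -card_supersets -[X in X%:R / _]sum1_card natr_sum.
rewrite [X in _ * X]mulr_suml mulr_sumr.
rewrite [RHS]big_mkcond; apply: eq_bigr => m' _; rewrite inE.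
case: (boolP (B m')) => Bm'; rewrite ?andbT ?andbF; last first.
  apply: big_pred0 => f.
  case: (at_time f (s + k) =P m') => [->|]; last by rewrite andbF.
  by rewrite (negbTE Bm') !andbF.
rewrite (@pr_ext _ (fun f =>
    [&& A f, at_time f s == m & at_time f (s + k) == m'])); last first.
  by move=> f; case: (at_time f (s + k) =P m') => [->|]; rewrite ?andbF // Bm' !andbT.
by rewrite pr_trans // /transition; case: ifP => _ //; rewrite mul0r mulr0.
Qed.

(** Almost sure monotonicity: given the state [m] at time [s], the state at time [t] has the form
    [m :|: S]. *)
Lemma pr_not_subset s t : (s <= t <= n)%N ->
  pr (fun f => ~~ (at_time f s \subset at_time f t)) = 0.
Proof.
case/andP => st tn; rewrite (pr_part _ (fun f => at_time f s)) big1 // => m _.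
have pT : past s xpredT by [].
have skn : (s + (t - s) <= n)%N by rewrite subnKC.
have := pr_trans_pred m (fun m' => ~~ (m \subset m')) pT skn.
rewrite [X in X%:R / _](_ : _ = 0%N) ?mul0r ?mulr0; last first.
  apply/eqP; rewrite cards_eq0; apply/eqP/setP => S.
  by rewrite !inE subsetUl !andbF.
rewrite subnKC // => <-; apply: pr_ext => f /=.
by rewrite andbC; apply: andb_id2l => /eqP ->.
Qed.

(** This lets the random time [tau] be read off the conditioning state, as its number of mines. *)
Lemma pr_card_neq t : (t <= n)%N -> pr (fun f => #|at_time f t| != t) = 0.
Proof.
move=> tn; apply/eqP; rewrite eq_le pr_ge0 andbT.
have pT : past 0 xpredT by [].
have := pr_trans_pred set0 (fun m' => #|m'| != t) pT tn.
rewrite [X in X%:R / _](_ : _ = 0%N) ?mul0r ?mulr0 => [h0|]; last first.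
  apply/eqP; rewrite cards_eq0; apply/eqP/setP => S.
  by rewrite !inE set0U; case: eqP; rewrite !andbF.
rewrite -[leRHS](addr0 0) -{1}p_start -h0.
rewrite (_ : _ + _ = \sum_(b <- [:: true; false])
  pr (if b then (fun f => at_time f 0 != set0)
      else (fun f => [&& true, at_time f 0 == set0 & #|at_time f (0 + t)| != t]))).
  apply: pr_union => f ft; have [f0|f0] := boolP (at_time f 0 == set0).
    by exists false; rewrite //= f0 add0n ft.
  by exists true.
by rewrite !big_cons big_nil addr0.
Qed.

(** Union bound in two phases: up to [t1], losing [B] requires a hit of [W], visible at [t1] by
    monotonicity and bounded by [draws_hit]; from [t1] to [t2], each time costs [c]. *)
Lemma pr_lost (B : pred {set T}) (W m : {set T}) (E : pred Omega)
    (t0 t1 t2 w : nat) (c : R) :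
  past t0 E -> (forall f, E f -> at_time f t0 = m) ->
  (t0 <= t1 <= t2)%N -> (t2 <= n)%N -> (#|W| <= w)%N ->
  (forall S : {set T}, S :&: W = m :&: W -> B S) -> 0 <= c ->
  (forall k, (t1 - t0 <= k <= t2 - t0)%N ->
    (draws (~: m) k (fun S => ~~ B (m :|: S)))%:R <= c * 'C(#|~: m|, k)%:R) ->
  pr (fun f => E f && [exists t : 'I_t2.+1, (t0 < t)%N && ~~ B (at_time f t)]) <=
  pr E * ((w * (t1 - t0))%:R / #|~: m|%:R + t2.+1%:R * c).
Proof.
move=> pE Em /andP[t01 t12] t2n Ww hW c0 hc.
have EE : pr E = pr (fun f => E f && (at_time f t0 == m)).
  by apply: pr_ext => f; apply/idP/andP => [Ef|[]//]; rewrite (Em f Ef).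
pose hit := fun f : Omega => E f && (at_time f t1 :&: W != m :&: W).
pose lost t := fun f : Omega => E f && ~~ B (at_time f t).
pose I2 := ('I_n.+1 * 'I_n.+1)%type.
(* The failures of monotonicity enter the union bound as null events. *)
pose nest (u : I2) := fun f : Omega =>
  ~~ (at_time f u.1 \subset at_time f u.2).
have le_k k : (t1 - t0 <= k <= t2 - t0)%N -> pr (lost (t0 + k)%N) <= pr E * c.
  move=> hk; have kn : (t0 + k <= n)%N by lia.
  have := pr_trans_pred m (fun S => ~~ B S) pE kn.
  rewrite -EE => h.
  apply: (@le_trans _ _ (pr E *
    ((draws (~: m) k (fun S => ~~ B (m :|: S)))%:R / 'C(#|~: m|, k)%:R))).
    by rewrite -h; apply: pr_le => f /andP[Ef ->]; rewrite Ef Em //= eqxx.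
  apply: ler_wpM2l; first exact: pr_ge0.
  have [->|Cn0] := eqVneq 'C(#|~: m|, k) 0%N; first by rewrite invr0 mulr0.
  by rewrite ler_pdivrMr ?hc // ltr0n lt0n.
have hit_le : pr hit <= pr E * ((w * (t1 - t0))%:R / #|~: m|%:R).
  have kn : (t0 + (t1 - t0) <= n)%N by lia.
  have := pr_trans_pred m (fun S => S :&: W != m :&: W) pE kn.
  rewrite -EE subnKC // => h.
  apply: (@le_trans _ _ (pr (fun f =>
    [&& E f, at_time f t0 == m & at_time f t1 :&: W != m :&: W]))).
    by apply: pr_le => f /andP[Ef ->]; rewrite Ef (Em f Ef) eqxx.
  rewrite h; apply: ler_wpM2l; first exact: pr_ge0.
  set k := (t1 - t0)%N.
  have hd : (draws (~: m) k (fun S => (m :|: S) :&: W != m :&: W)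
              <= draws (~: m) k (fun S => ~~ [disjoint S & W]))%N.
    apply/subset_leq_card/subsetP => S; rewrite !inE => /and3P[-> -> /=].
    by apply: contra => dS; rewrite setIUl (disjoint_setI0 dS) setU0.
  have := draws_hit (~: m) k Ww; move/(leq_trans (leq_mul hd (leqnn _))).
  (* Division by 0 gives 0, so the left side has to vanish: for [k > 0] the binomial is 0, and for
     [k = 0] only the empty set is drawn, which changes nothing on [W]. *)
  have [N0|N0] := eqVneq #|~: m| 0%N.
    move=> _; rewrite N0 invr0 mulr0 bin0n.
    move: hd; case: k {h} => [|k] hd; rewrite /= ?invr0 ?mulr0 //.
    rewrite (_ : draws _ _ _ = 0%N) ?mul0r //; apply/eqP; rewrite cards_eq0.
    apply/eqP/setP => S; rewrite !inE; apply/negbTE/negP => /and3P[_ /eqP/eqP].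
    by rewrite cards_eq0 => /eqP ->; rewrite setU0 eqxx.
  have [->|Cn0] := eqVneq 'C(#|~: m|, k) 0%N.
    by rewrite invr0 mulr0 => _; rewrite divr_ge0.
  move=> hN; rewrite ler_pdivrMr ?ltr0n ?lt0n // mulrAC ler_pdivlMr ?ltr0n ?lt0n //.
  by rewrite -!natrM ler_nat.
pose us := [seq u : I2 <- enum [set: I2] | (u.1 <= u.2)%N].
have nest0 (u : I2) : u \in us -> pr (nest u) = 0.
  by rewrite mem_filter => /andP[u12 _]; apply: pr_not_subset; rewrite u12 leq_ord.
pose ts := [seq t <- iota 0 t2.+1 | (t1 <= t)%N].
pose ev (e : option (nat + I2)) : pred Omega :=
  match e with None => hit | Some (inl t) => lost t | Some (inr u) => nest u end.
pose es := None :: [seq Some (inl t) | t <- ts] ++ [seq Some (inr u) | u <- us].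
have -> : pr E * ((w * (t1 - t0))%:R / #|~: m|%:R + t2.+1%:R * c) =
  pr E * ((w * (t1 - t0))%:R / #|~: m|%:R) + t2.+1%:R * (pr E * c).
  by rewrite mulrDr [pr E * (_ * c)]mulrCA.
apply: (@le_trans _ _ (\sum_(e <- es) pr (ev e))).
  apply: pr_union => f /andP[Ef /existsP[t /andP[t0t nB]]].
  have tn : (t <= n)%N by have := ltn_ord t; lia.
  have [t1t|tt1] := leqP t1 t.
    exists (Some (inl (t : nat))); last by rewrite /= /lost Ef.
    rewrite inE mem_cat map_f // mem_filter t1t mem_iota; exact: ltn_ord.
  have ex_nest s s' : (s <= s' <= n)%N -> ~~ (at_time f s \subset at_time f s') ->
      exists2 i, i \in es & ev i f.
    move=> ss' ns; exists (Some (inr (inord s, inord s'))).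
      rewrite inE mem_cat; apply/orP; right; apply/orP; right.
      by apply: map_f; rewrite mem_filter mem_enum inE /= !inordK; lia.
    by rewrite /= /nest /= !inordK //; lia.
  have [s1|] := boolP (at_time f t0 \subset at_time f t); last by apply: ex_nest; lia.
  have [s2|] := boolP (at_time f t \subset at_time f t1); last by apply: ex_nest; lia.
  (* The state at [t] lies between [m] and the state at [t1]; if these two agree on [W], it agrees
     with them there. *)
  exists None; rewrite ?mem_head //= /hit Ef /=; apply: contra nB => /eqP h1.
  apply: hW; apply/eqP; rewrite eqEsubset -{1}h1 setSI //= setSI //.
  by rewrite -(Em f Ef).
rewrite big_cons big_cat !big_map /= lerD //.
rewrite [X in _ + X]big_seq [X in _ + X]big1 ?addr0; last first.
  by move=> u /nest0.
rewrite big_seq; apply: (@le_trans _ _ (\sum_(t <- ts | t \in ts) pr E * c)).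
  apply: ler_sum => t; rewrite mem_filter mem_iota => /andP[t1t t2t].
  have := le_k (t - t0)%N; rewrite subnKC; last by lia.
  by apply; lia.
rewrite -big_seq big_const_seq count_predT iter_addr_0 -[leLHS]mulr_natl.
apply: ler_wpM2r; first by rewrite mulr_ge0 // pr_ge0.
by rewrite ler_nat size_filter; apply: leq_trans (count_size _ _) _; rewrite size_iota.
Qed.

End PathLaw.

(* From the mine process to a finite path law *)
From mathcomp Require Import all_classical all_reals all_analysis.
Local Open Scope classical_set_scope.

Lemma mine_stepE (R : realType) (a b : nat) (m m' : mines a b) :
  mine_step R m m' = transition R 1 m m'.
Proof.
rewrite /mine_step /transition bin1 -mulr_suml -natr_sum; congr (_%:R / _).
case: (boolP (_ && _)) => [/andP[sm /eqP cm]|nm]; last first.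
  rewrite big1 // => c cm; case: eqP => // mm'; case/negP: nm.
  by rewrite -mm' finset.subsetUr cardsU1 -finset.in_setC cm addnC eqxx.
have /cards1P[x xE] : #|m' :\: m|%SET == 1%N.
  by rewrite cardsD (finset.setIidPr sm) cm addKn.
have /finset.setDP[xm' xm] : x \in (m' :\: m)%SET by rewrite xE finset.set11.
rewrite (bigD1 x) ?finset.in_setC //= big1 => [|c /andP[mc nc]].
  by rewrite -xE finset.setUC -{1}(finset.setIidPr sm) finset.setID eqxx.
case: eqP => // mm'; case/negP: nc.
have : c \in (m' :\: m)%SET.
  by rewrite finset.in_setD -mm' finset.setU11 -finset.in_setC mc.
by rewrite xE finset.in_set1.
Qed.

Section Bridge.
Variables (R : realType) (d : measure_display) (T : measurableType d).
Variables (P : probability T R) (a b : nat) (M : nat -> T -> mines a b).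
Hypothesis MP : mine_process P M.
Let n := (a * b)%N.
Let Omega := {ffun 'I_n.+1 -> {set cell a b}}.

(** Cut at time [n], since [mine_process] does not constrain later times. *)
Definition trajectory (w : T) : Omega := [ffun i : 'I_n.+1 => M i w].

Definition path_law (f : Omega) : R := fine (P [set w | trajectory w = f]).

Lemma at_trajectory w s : (s <= n)%N -> at_time (trajectory w) s = M s w.
Proof. by move=> sn; rewrite /at_time ffunE inordK. Qed.

Lemma measurable_trajectory f : measurable [set w | trajectory w = f].
Proof.
case: MP => mM _ _.
rewrite (_ : [set _ | _] = \bigcap_(i in [set: 'I_n.+1]) [set w | M i w = f i]).
  by apply: fin_bigcap_measurable => // i _; apply: mM; rewrite leq_ord.
apply/seteqP; split=> w /= => [<- i _|h]; first by rewrite /= ffunE.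
by apply/ffunP => i; rewrite ffunE; apply: h.
Qed.

Lemma path_law_ge0 f : 0 <= path_law f.
Proof. exact/fine_ge0/measure_ge0. Qed.

(** There are finitely many trajectories, so the event is a finite disjoint union of measurable
    fibres. *)
Lemma P_trajectory (A : pred Omega) :
  P [set w | A (trajectory w)] = (pr path_law A)%:E.
Proof.
rewrite (_ : [set _ | _] =
  \bigcup_(f in [set` enum A]) [set w | trajectory w = f]); last first.
  apply/seteqP; split=> w /= => [Aw|[f]].
    by exists (trajectory w) => //=; rewrite mem_enum.
  by rewrite /= mem_enum => Af ->.
rewrite measure_fin_bigcup //; last 2 first.
- by move=> f g _ _ [w [/= <- <-]].
- by move=> f _; apply: measurable_trajectory.
rewrite -fsbig_seq ?enum_uniq // big_enum /= /pr -sumEFin.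
apply: eq_bigr => f _; rewrite /path_law fineK //.
exact/fin_num_measure/measurable_trajectory.
Qed.

Lemma path_law_start : pr path_law (fun f => at_time f 0 != finset.set0) = 0.
Proof.
case: MP => _ M0 _; have := P_trajectory (fun f => at_time f 0 == finset.set0).
rewrite (_ : [set _ | _] = [set w | M 0%N w = finset.set0]) ?M0; last first.
  by apply/seteqP; split=> w /=; rewrite at_trajectory // => /eqP.
have := P_trajectory xpredT; rewrite (_ : [set _ | _] = setT) ?probability_setT.
  move=> [h1] [h0]; move: h1; rewrite {1}/pr.
  rewrite (bigID (fun f => at_time f 0 == finset.set0)) /= => h1.
  by apply: (@addrI _ 1); rewrite addr0 {1}h0 h1.
by apply/seteqP.
Qed.

Lemma path_law_step t g : (t < n)%N ->
  pr path_law (agree t.+1 ^~ g) =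
  pr path_law (agree t ^~ g) * transition R 1 (at_time g t) (at_time g t.+1).
Proof.
case: MP => _ _ Ms tn; have := Ms t (at_time g) tn.
have agE s : (s <= n)%N ->
    [set w | forall i, (i <= s)%N -> M i w = at_time g i] =
    [set w | agree s (trajectory w) g].
  move=> sn; apply/seteqP; split=> w /= => [h|/agreeP h i is_].
    by apply/agreeP => i is_ ni; rewrite at_trajectory ?h.
  by rewrite -h ?at_trajectory //; apply: leq_trans sn.
rewrite !agE ?(ltnW tn) // (P_trajectory (agree t.+1 ^~ g)).
by rewrite (P_trajectory (agree t ^~ g)) mine_stepE -EFinM => -[].
Qed.

End Bridge.

(** * The first occurrence time and the conditioning event *)

Lemma ohead_filter_iota (q : pred nat) i k t :
  ohead [seq s <- iota i k | q s] = Some t <->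
  [/\ (i <= t < i + k)%N, q t & forall s, (i <= s < t)%N -> ~~ q s].
Proof.
elim: k i => [|k IHk] i /=; first by split=> // -[]; lia.
case: (boolP (q i)) => qi /=.
  split=> [[<-]|[h1 h2 h3]]; first by split=> //; lia.
  have [it|it|->//] := ltngtP i t; last by lia.
  by move: (h3 i); rewrite leqnn it qi => /(_ isT).
rewrite IHk; split=> -[h1 h2 h3]; split=> //.
- by lia.
- move=> s hs; have [<-//|si] := eqVneq i s; apply: h3; lia.
- have [E|] := eqVneq i t; last by lia.
  by move: h2; rewrite -E (negbTE qi).
- by move=> s hs; apply: h3; lia.
Qed.

Lemma tauP a b (x : nat -> mines a b) t :
  tau x = Some t <->
  [/\ (t <= a * b)%N, has_pattern (x t)
    & forall s, (s < t)%N -> ~~ has_pattern (x s)].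
Proof. by rewrite /tau ohead_filter_iota. Qed.

Lemma eq_tau a b (x y : nat -> mines a b) :
  (forall s, (s <= a * b)%N -> x s = y s) -> tau x = tau y.
Proof.
move=> xy; congr ohead; apply: eq_in_filter => s.
by rewrite mem_iota => /xy ->.
Qed.

Section Early.
Variables (R : realType) (d : measure_display) (T : measurableType d).
Variables (P : probability T R) (a b : nat) (M : nat -> T -> mines a b).
Hypothesis MP : mine_process P M.
Let n := (a * b)%N.
Let Omega := {ffun 'I_n.+1 -> {set cell a b}}.
Let p := path_law P M.

Definition early_path (m : mines a b) (f : Omega) : bool :=
  if tau (at_time f) is Some t
  then (t%:R < n%:R `^ (9 / 10) :> R) && (at_time f t == m) else false.

(** Restricting [t] to times up to [n] loses nothing, because [t < n / 2]. *)
Definition persistent_path (f : Omega) : bool :=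
  if tau (at_time f) is Some s
  then [forall t : 'I_n.+1, (s < t)%N && (t%:R < n%:R / 2 :> R) ==>
          has_pattern (at_time f t)]
  else true.

Lemma tau_trajectory w : tau (at_time (trajectory M w)) = tau (M^~ w).
Proof. by apply: eq_tau => s sn; rewrite at_trajectory. Qed.

Lemma early_firstE (m : mines a b) : early_first_occurrence R M m =
  [set w | early_path m (trajectory M w)].
Proof.
apply/seteqP; split=> w /=; rewrite /early_path tau_trajectory.
  case=> t [tau_t tn <-]; rewrite tau_t tn at_trajectory ?eqxx //.
  by case/tauP: tau_t.
case tau_t: (tau _) => [t|//] /andP[tn /eqP tm].
by exists t; rewrite -tm at_trajectory //; case/tauP: tau_t.
Qed.

Lemma persists_earlyE (m : mines a b) :
  pattern_persists R M `&` early_first_occurrence R M m =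
  [set w | early_path m (trajectory M w) && persistent_path (trajectory M w)].
Proof.
rewrite early_firstE; apply/seteqP; split=> w /=.
  case=> pers ->; rewrite /persistent_path tau_trajectory.
  case tau_t: (tau _) => [s|//]; apply/forallP => t; apply/implyP => /andP[st tn].
  by rewrite at_trajectory ?leq_ord //; apply: pers tau_t st tn.
case/andP => -> pers; split=> // s t tau_s st tn.
move: pers; rewrite /persistent_path tau_trajectory tau_s.
have tN : (t < n.+1)%N.
  rewrite ltnS -(ler_nat R); apply/ltW/(lt_le_trans tn).
  by rewrite ler_pdivrMr // ler_peMr ?ler1n.
move/forallP => /(_ (Ordinal tN)) /implyP /=; rewrite at_trajectory //.
by apply; rewrite st.
Qed.

(** The conditioning event with the random time [tau] replaced by the fixed time [#|m|]; it then
    belongs to the past of that time and the Markov property applies. *)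
Definition first_at (m : mines a b) (f : Omega) : bool :=
  [forall s : 'I_#|m|, ~~ has_pattern (at_time f s)] && (at_time f #|m| == m).

Lemma past_first_at (m : mines a b) : (#|m| <= n)%N -> past #|m| (first_at m).
Proof.
move=> mn f g fg.
have h (s : nat) : (s <= #|m|)%N -> at_time f s = at_time g s.
  by move=> sm; move/agreeP: fg => /(_ s sm (leq_trans sm mn)).
have hm := h _ (leqnn _).
apply: (f_equal2 andb); last by rewrite hm.
by apply: eq_forallb => s; rewrite (h s (ltnW (ltn_ord s))).
Qed.

Lemma first_at_early (m : mines a b) f : has_pattern m -> (#|m| <= n)%N ->
  #|m|%:R < n%:R `^ (9 / 10) :> R -> first_at m f -> early_path m f.
Proof.
move=> hm mn mlt /andP[/forallP hf /eqP fm]; rewrite /early_path.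
have /tauP -> : [/\ (#|m| <= n)%N, has_pattern (at_time f #|m|)
    & forall s, (s < #|m|)%N -> ~~ has_pattern (at_time f s)].
  by rewrite fm; split=> // s sm; apply: (hf (Ordinal sm)).
by rewrite mlt fm eqxx.
Qed.

Lemma early_first_at (m : mines a b) f : early_path m f ->
  (forall t, (t <= n)%N -> #|at_time f t| = t) ->
  [/\ has_pattern m, (#|m| <= n)%N, #|m|%:R < n%:R `^ (9 / 10) :> R,
      first_at m f & tau (at_time f) = Some #|m|].
Proof.
rewrite /early_path; case tau_t: (tau _) => [t|//] /andP[tlt /eqP fm] card_f.
have [tn ht hs] := (tauP _ _).1 tau_t.
have tm : t = #|m| by rewrite -fm card_f.
rewrite -tm; split=> //; first by rewrite -fm.
rewrite /first_at -tm fm eqxx andbT; apply/forallP => s; exact: hs.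
Qed.

Let path_ge0 : forall f, 0 <= p f := path_law_ge0 P M.
Let path_start := path_law_start MP.
Let path_step := path_law_step MP.

(** Inclusion up to a null set: the paths whose state at some time has the wrong size are
    discarded. *)
Lemma pr_le_cards (A B : pred Omega) :
  (forall f, A f -> (forall t, (t <= n)%N -> #|at_time f t| = t) -> B f) ->
  pr p A <= pr p B.
Proof.
move=> AB.
pose ev (t : option nat) : pred Omega :=
  if t is Some t then fun f => #|at_time f t| != t else B.
pose ts := None :: [seq Some t | t <- iota 0 n.+1].
apply: (@le_trans _ _ (\sum_(t <- ts) pr p (ev t))).
  apply: pr_union => // f Af.
  case: (boolP (all (fun t => #|at_time f t| == t) (iota 0 n.+1))).
    move/allP => h; exists None; rewrite ?mem_head //; apply: (AB f Af) => t tn.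
    by apply/eqP/h; rewrite mem_iota.
  by case/allPn => t tn ft; exists (Some t); rewrite // inE map_f.
rewrite big_cons big_map big_seq big1 ?addr0 // => t.
by rewrite mem_iota => tn; apply: pr_card_neq.
Qed.

Lemma early_conditions (m : mines a b) :
  (0 < P (early_first_occurrence R M m))%E ->
  [/\ has_pattern m, (#|m| <= n)%N & #|m|%:R < n%:R `^ (9 / 10) :> R].
Proof.
rewrite early_firstE (P_trajectory MP (early_path m)) lte_fin -/p => early_gt0.
apply/and3P; apply: contraLR early_gt0 => /negP nm.
rewrite -leNgt; apply: le_trans (pr_le_cards (B := pred0) _) _.
  move=> f fe card_f; case: nm.
  by have [-> -> -> _ _] := early_first_at fe card_f.
by rewrite /pr big_pred0.
Qed.

Lemma pr_early_not_persistent (m : mines a b) :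
  pr p (fun f => early_path m f && ~~ persistent_path f) <=
  pr p (fun f => first_at m f && [exists t : 'I_(n %/ 2).+1,
                    (#|m| < t)%N && ~~ has_pattern (at_time f t)]).
Proof.
apply: pr_le_cards => f /andP[fe np] card_f.
have [hm mn mlt -> tau_m] := early_first_at fe card_f.
move: np; rewrite /persistent_path tau_m negb_forall => /existsP[t].
rewrite negb_imply => /andP[/andP[mt tn] nt].
(* The real bound [t < n / 2] gives [t <= n %/ 2] for integers. *)
have t2 : (t < (n %/ 2).+1)%N.
  move: tn; rewrite ltr_pdivlMr // -natrM ltr_nat => tn.
  by rewrite ltnS leq_divRL // ltnW.
by apply/existsP; exists (Ordinal t2); rewrite mt.
Qed.

(** The non-persistent part of the conditioning event has probability at most that of [first_at m]
    times the bound of [pr_lost], and [first_at m] is contained in the conditioning event. *)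
Lemma cond_prob_early (m W : mines a b) (t1 w : nat) (c eps : R) :
  (0 < P (early_first_occurrence R M m))%E ->
  (#|W| <= w)%N ->
  (forall S : mines a b, (S :&: W = m :&: W)%SET -> has_pattern S) -> 0 <= c ->
  (#|m| <= t1 <= n %/ 2)%N ->
  (forall k, (t1 - #|m| <= k <= n %/ 2 - #|m|)%N ->
    (draws (~: m)%SET k (fun S => ~~ has_pattern (m :|: S)%SET))%:R
      <= c * 'C(#|(~: m)%SET|, k)%:R) ->
  (w * (t1 - #|m|))%:R / #|(~: m)%SET|%:R + (n %/ 2).+1%:R * c < eps ->
  1 - eps < cond_prob P (pattern_persists R M) (early_first_occurrence R M m).
Proof.
move=> early_gt0; have [hm mn mlt] := early_conditions early_gt0.
move: early_gt0; rewrite /cond_prob persists_earlyE early_firstE.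
rewrite (P_trajectory MP (early_path m)).
rewrite (P_trajectory MP (fun f => early_path m f && persistent_path f)) /= lte_fin.
rewrite -/p => early_gt0 Ww hW c0 t1P hc small.
rewrite ltr_pdivlMr // mulrBl mul1r ltrBlDr.
rewrite [ltLHS](_ : _ = pr p (fun f => early_path m f && persistent_path f) +
    pr p (fun f => early_path m f && ~~ persistent_path f)); last first.
  by rewrite /pr (bigID persistent_path).
rewrite ltrD2l; apply: le_lt_trans (pr_early_not_persistent m) _.
have first_m f : first_at m f -> at_time f #|m| = m by case/andP => _ /eqP.
have n2n : (n %/ 2 <= n)%N by exact: leq_div.
have := pr_lost path_ge0 path_step (past_first_at mn) first_m t1P n2n Ww hW c0 hc.
move/le_lt_trans; apply.
apply: (@le_lt_trans _ _ (pr p (early_path m) *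
  ((w * (t1 - #|m|))%:R / #|(~: m)%SET|%:R + (n %/ 2).+1%:R * c))).
  apply: ler_wpM2r; first by rewrite addr_ge0 // ?divr_ge0 // mulr_ge0.
  by apply: pr_le => // f; apply: first_at_early.
by rewrite mulrC ltr_pM2r.
Qed.

End Early.

(** * Numerical estimates and conclusion *)

(** [draws_misses] with [A = 4 * K] and [w = 64] on [L = n %/ (512 * K)] clean tiles. These use at
    most [64 * L <= n / (8 * K)] cells, a small part of both the drawn and the undrawn ones. *)
Lemma draws_pattern_free (a b K k : nat) (m : mines a b) :
  (8 <= a)%N -> (8 <= b)%N -> (0 < K)%N -> (4 * K <= a * b)%N ->
  (#|m| * (512 * K) <= a * b)%N ->
  (a * b %/ K - #|m| <= k <= a * b %/ 2 - #|m|)%N ->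
  (draws (~: m)%SET k (fun S => ~~ has_pattern (m :|: S)%SET)
    * ((4 * K) ^ 64) ^ (a * b %/ (512 * K))
  <= ((4 * K) ^ 64).-1 ^ (a * b %/ (512 * K)) * 'C(#|(~: m)%SET|, k))%N.
Proof.
move=> a8 b8 K0; set n := (a * b)%N; set L := (n %/ (512 * K))%N => Kn mK /andP[k1 k2].
have cN : (#|(~: m)%SET| = n - #|m|)%N.
  by have := cardsC m; rewrite card_prod !card_ord -/n; lia.
have LK : (L * (512 * K) <= n)%N by rewrite /L leq_divM.
have mL : (#|m| * 512 <= n)%N by apply: leq_trans mK; rewrite leq_mul2l; lia.
have L8 : (L * 512 <= n)%N by apply: leq_trans LK; rewrite leq_mul2l; lia.
(* Rounding to multiples of 8 loses at most a factor 2 per side, as both sides are at least 8. *)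
have nwin : (n <= 256 * ((a %/ 8) * (b %/ 8)))%N.
  have ha : (a <= 16 * (a %/ 8))%N by lia.
  have hb : (b <= 16 * (b %/ 8))%N by lia.
  by apply: leq_trans (leq_mul ha hb) _; lia.
have hL : (L + #|m| <= (a %/ 8) * (b %/ 8))%N by lia.
have [ws [sL ws1 ws2 ws3]] := clean_windows hL.
have n4 : (4 <= n)%N by lia.
have := draws_misses (A := (4 * K)%N) (w := 64) (k := k) _ ws1 ws2.
rewrite sL => /(_ _ _ _)/(leq_trans _); apply.
- rewrite leq_mul2r; apply/orP; right.
  apply/subset_leq_card/fintype.subsetP => S; rewrite !finset.inE.
  by case/and3P => -> -> /ws3 ->.
- by lia.
(* Up to the rounding, at most [n / (4 * K)] by [4 * K <= n], [k] is at least [n / K - #|m|];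
   subtracting [64 * L] leaves more than [n / (4 * K)]. *)
- have : (n < (n %/ K).+1 * K)%N by rewrite ltn_ceil.
  have : (K * (64 * L) * 8 <= n)%N by lia.
  have : (K * #|m| * 512 <= n)%N by lia.
  move=> h1 h2 h3.
  rewrite cN -mulnA mulnBr; move: (n %/ K)%N k1 h3 => q k1.
  rewrite mulSn mulnC => h3.
  have h4 : (K * q <= K * k + K * #|m|)%N by rewrite -mulnDr leq_mul2l; lia.
  lia.
(* At least [n / 2] cells remain undrawn, and at least [n / 4] after removing [64 * L]. *)
- have : (64 * L * 8 <= n)%N by lia.
  move=> h1; rewrite cN.
  have : (n <= 4 * (n - #|m| - k - 64 * L))%N by lia.
  move=> h2; apply: (leq_trans (leq_subr _ _)); apply: (leq_trans h2).
  by rewrite leq_mul2r leq_pmulr ?orbT.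
Qed.

(** Each of the [L.+1] terms [s ^+ i] with [i <= L] is at least [s ^+ L], and their sum times
    [1 - s] is [1 - s ^+ L.+1]. Keeping [s ^+ L.+1] on the left makes the induction go through. *)
Lemma mulS_geometric (R : realType) (s : R) (L : nat) : 0 <= s <= 1 ->
  L.+1%:R * s ^+ L * (1 - s) <= 1.
Proof.
case/andP => s0 s1; suff : L.+1%:R * s ^+ L * (1 - s) + s ^+ L.+1 <= 1.
  by apply: le_trans; rewrite lerDl exprn_ge0.
elim: L => [|L IHL]; first by rewrite expr0 expr1 !mul1r subrK.
rewrite (_ : _ + _ = s * (L.+1%:R * s ^+ L * (1 - s) + s ^+ L.+1)
                     + s ^+ L.+1 * (1 - s)); last first.
  by rewrite -[L.+2%:R]natr1 !exprS; ring.
apply: (@le_trans _ _ (s * 1 + 1 * (1 - s))); last by rewrite mulr1 mul1r addrC subrK.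
apply: lerD; first exact: ler_wpM2l.
by apply: ler_wpM2r; rewrite ?subr_ge0 // exprn_ile1.
Qed.

Lemma mul_geometric_lt (R : realType) (r eps : R) (J : nat) :
  0 <= r < 1 -> 0 < eps -> (0 < J)%N ->
  exists n0, forall n, (n0 <= n)%N -> n%:R * r ^+ (n %/ J) < eps.
Proof.
case/andP => r0 r1 eps0 J0; pose s := (1 + r) / 2.
have s0 : 0 <= s by rewrite /s; lra.
have s1 : s < 1 by rewrite /s; lra.
(* AM-GM; the factor n is then absorbed by one of the two copies of s ^+ L. *)
have rs : r <= s ^+ 2 by rewrite /s expr2; nra.
(* With [L = n %/ J], [n <= J * L.+1] and [mulS_geometric] bound the product by
   [J * s ^+ L / (1 - s)], whence this threshold for [s ^+ L]. *)
have e0 : 0 < eps * (1 - s) / J%:R by rewrite divr_gt0 ?ltr0n // mulr_gt0 // subr_gt0.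
have sn : `|s| < 1 by rewrite ger0_norm.
have [L0 _ hL0] := (cvgr0Pnorm_lt _).1 (cvg_expr sn) _ e0.
exists (L0 * J)%N => n; rewrite -leq_divRL // => /hL0 /=.
have : n%:R <= J%:R * (n %/ J).+1%:R :> R.
  by rewrite -natrM ler_nat mulnC ltnW // ltn_ceil.
move: (n %/ J)%N => L nJ; rewrite ger0_norm ?exprn_ge0 // ltr_pdivlMr ?ltr0n // => sL.
rewrite -(ltr_pM2r (x := 1 - s)) ?subr_gt0 //; apply: le_lt_trans sL.
apply: (@le_trans _ _ (J%:R * L.+1%:R * (s ^+ 2) ^+ L * (1 - s))).
  apply: ler_wpM2r; first by rewrite subr_ge0 ltW.
  by apply: ler_pM; rewrite ?exprn_ge0 // lerXn2r ?nnegrE ?exprn_ge0.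
rewrite -exprM mulnC exprM expr2 -[leRHS]mulr1.
have := @mulS_geometric R s L; rewrite s0 ltW // => /(_ isT) h.
rewrite (_ : _ * _ * _ * _ = s ^+ L * J%:R * (L.+1%:R * s ^+ L * (1 - s)));
  last by ring.
by apply: ler_wpM2l => //; rewrite mulr_ge0 ?exprn_ge0.
Qed.

(** Factor [n] as [n ^ (9/10)] times [n ^ (1/10)]; the second factor is at least [J]. *)
Lemma powR_little (R : realType) (n m J : nat) : (J ^ 10 <= n)%N ->
  m%:R < n%:R `^ (9 / 10) :> R -> (m * J <= n)%N.
Proof.
move=> Jn mn; rewrite -(ler_nat R) natrM.
have nE : n%:R `^ (9 / 10) * n%:R `^ (1 / 10) = n%:R :> R.
  rewrite -powRD; last by apply/implyP => /eqP h; exfalso; lra.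
  by rewrite (_ : _ + _ = 1) ?powRr1 //; lra.
rewrite -[leRHS]nE; apply: ler_pM; rewrite ?ler0n ?(ltW mn) //.
have -> : J%:R = (J ^ 10)%N%:R `^ (1 / 10) :> R.
  rewrite natrX -powR_mulrn // -powRrM (_ : _ * _ = 1) ?powRr1 //.
  by rewrite mulrC divfK // pnatr_eq0.
by rewrite ge0_ler_powR ?nnegrE ?ler_nat ?divr_ge0.
Qed.

Theorem proposition18 (R : realType) (a b : nat -> nat)
    (a_oo : a @ \oo --> \oo) (b_oo : b @ \oo --> \oo)
    (d : nat -> measure_display) (T : forall N, measurableType (d N))
    (P : forall N, probability (T N) R)
    (M : forall N, nat -> T N -> mines (a N) (b N))
    (M_process : forall N, mine_process (P N) (M N)) :
  forall eps : R, 0 < eps ->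
  \forall N \near \oo, forall m : mines (a N) (b N),
    (0 < P N (early_first_occurrence R (M N) m))%E ->
    1 - eps < cond_prob (P N) (pattern_persists R (M N))
                (early_first_occurrence R (M N) m).
Proof.
move=> eps eps0.
(* [K > 256 / eps] makes the hitting probability [128 / K] less than [eps / 2]; the shift by 2 gives
   [K >= 2], so that [n %/ K <= n %/ 2]. *)
pose K := (Num.bound (256 / eps)).+2.
have K0 : (0 < K)%N by [].
have KR : 256 / eps < K%:R.
  apply: lt_trans (archi_boundP _) _; first by rewrite divr_ge0 // ltW.
  by rewrite ltr_nat.
have K2 : (2 <= K)%N by [].
move: K K0 K2 KR => K K0 K2 KR.
have draws_le a' b' k (m : mines a' b') (a8 : (8 <= a')%N) (b8 : (8 <= b')%N) :=
  @draws_pattern_free a' b' K k m a8 b8 K0.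
have little (n m : nat) := @powR_little R n m (512 * K).
have C0 : (0 < (4 * K) ^ 64)%N by rewrite expn_gt0 muln_gt0 K0.
have KJ : (2 * K <= 512 * K)%N by rewrite leq_mul2r orbT.
(* From here [C], [J] and [X] stand for these large constants; only the recorded inequalities about
   them are used. *)
move: ((4 * K) ^ 64)%N (512 * K)%N ((512 * K) ^ 10)%N C0 KJ little draws_le.
move=> C J X C0 KJ little draws_le.
have J0 : (0 < J)%N by lia.
have CR0 : 0 < C%:R :> R by rewrite ltr0n.
pose r : R := C.-1%:R / C%:R.
have r01 : 0 <= r < 1.
  by rewrite divr_ge0 //= ltr_pdivrMr // mul1r ltr_nat ltn_predL.
have [n0 hn0] := mul_geometric_lt r01 (divr_gt0 eps0 (ltr0Sn _ 1)) J0.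
(* Since [n >= a N], the bounds required of [n] can all be put on [a]: [n0] for the geometric decay,
   [4 * K] for [draws_pattern_free], [X] for [powR_little]. The 8 lets windows fit. *)
have [Na _ near_a] := (cvgnyPge _).1 a_oo (n0 + 4 * K + X + 8)%N.
have [Nb _ near_b] := (cvgnyPge _).1 b_oo 8%N.
exists (maxn Na Nb) => // N /=.
rewrite geq_max => /andP[/near_a /= aN /near_b /= bN] m early_gt0.
have [hm mn mlt] := early_conditions (M_process N) early_gt0.
have [W W64 hW] := pattern_window hm.
set n := (a N * b N)%N in mn mlt *.
have an : (n0 + 4 * K + X + 8 <= n)%N.
  by apply: leq_trans aN _; rewrite leq_pmulr //; lia.
have mJ : (#|m| * J <= n)%N by apply: little mlt; lia.
have m2 : (#|m| * 2 <= n)%N by apply: leq_trans mJ; rewrite leq_mul2l; lia.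
have cn : #|(~: m)%SET| = (n - #|m|)%N.
  by have := cardsC m; rewrite card_prod !card_ord -/n; lia.
apply: (cond_prob_early (M_process N) (W := W) (t1 := (n %/ K)%N) (w := 64)
  (c := r ^+ (n %/ J))) => //.
- by rewrite exprn_ge0 //; case/andP: r01.
- rewrite leq_divRL //; apply/andP; split; last exact: leq_div2l.
  by apply: leq_trans mJ; rewrite leq_mul2l; lia.
- move=> k hk; rewrite expr_div_n mulrAC ler_pdivlMr ?exprn_gt0 //.
  rewrite -!natrX -!natrM ler_nat; apply: draws_le => //; lia.
rewrite (splitr eps); apply: ltr_leD.
  rewrite cn ltr_pdivrMr; last by rewrite ltr0n; lia.
  rewrite -(ltr_pM2r (x := K%:R)) ?ltr0n // -natrM.
  (* The factor 128 is twice 64, because [#|m| <= n / 2] leaves at least [n / 2] empty cells. *)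
  apply: (@le_lt_trans _ _ (128 * (n - #|m|)%:R)).
    rewrite -natrM ler_nat.
    have : (n %/ K * K <= n)%N by exact: leq_divM.
    have : (64 * (n %/ K - #|m|) * K <= 64 * (n %/ K * K))%N.
      by rewrite -mulnA leq_mul2l leq_mul2r leq_subr orbT.
    by lia.
  rewrite mulrAC ltr_pM2r; last by rewrite ltr0n; lia.
  by move: KR; rewrite ltr_pdivrMr //; lra.
apply: le_trans (ltW (hn0 n _)); last by lia.
apply: ler_wpM2r; first by rewrite exprn_ge0 //; case/andP: r01.
by rewrite ler_nat; lia.
Qed.
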